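(* Let $G=(V,E)$ be a $k$-regular graph with $n$ vertices, adjacency matrix $A$, adjacency eigenvalues $\lambda_1\ge\cdots\ge\lambda_n$ (with multiplicity), and distinct adjacency eigenvalues $k=\theta_0>\theta_1>\cdots>\theta_d$ with $d\ge2$. Let $\theta_i$ be the largest eigenvalue such that $\theta_i\le-1$. For $q\in\mathbb{R}_2[x]$ put $W(q):=\max_{u\in V}\{(q(A))_{uu}\}$ and $\lambda(q):=\min_{2\le j\le n}\{q(\lambda_j)\}$, and, when $q(\lambda_1)>\lambda(q)$, put $R(q):=n\,\frac{W(q)-\lambda(q)}{q(\lambda_1)-\lambda(q)}$. Then, for $p(x)=x^2-(\theta_i+\theta_{i-1})x$, $$\mathrm{eq}_3(G)\le R(p)= n\,\frac{\theta_0+\theta_i\theta_{i-1}}{(\theta_0-\theta_i)(\theta_0-\theta_{i-1})}.$$ Moreover, this is the best possible bound of this type: $R(q)\ge R(p)$ for every $q\in\mathbb{R}_2[x]$ with $q(\lambda_1)>\lambda(q)$.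
   Context: Graphs are finite, simple and undirected; $d(u,v)$ is the shortest-path distance. $\mathbb{R}_2[x]$ is the set of real polynomials of degree at most $2$. A set $S\subseteq V$ is $3$-equidistant if $d(u,v)=3$ for all distinct $u,v\in S$, and $\mathrm{eq}_3(G)$ is the maximum size of such a set. (The ratio-type bound states that $\mathrm{eq}_3(G)\le R(q)$ for every regular $G$ and every $q\in\mathbb{R}_2[x]$ with $q(\lambda_1)>\lambda(q)$.) *)

(* Defs.v *)
(* The real numbers are an arbitrary [R : realType]. *)
From mathcomp Require Import all_boot all_order all_algebra.
From mathcomp Require Import polyrcf reals.

Set Implicit Arguments.
Unset Strict Implicit.
Unset Printing Implicit Defensive.

Import Order.TTheory GRing.Theory Num.Theory.
Local Open Scope ring_scope.

Section Graphs.
Variables (V : finType) (e : rel V).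
Local Open Scope nat_scope.

(* The simple graphs are the symmetric irreflexive relations [e]. *)
Definition regular (k : nat) := forall u : V, #|[set v | e u v]| = k.

Definition has_walk (m : nat) (u v : V) : bool :=
  [exists p : m.-tuple V, path e u p && (last u p == v)].

(* [None] stands for infinite distance; a shortest walk is a path, so only
   lengths below [#|V|] have to be searched. *)
Definition dist (u v : V) : option nat :=
  ohead [seq m <- iota 0 #|V| | has_walk m u v].

Definition equidistant (m : nat) (S : {set V}) : bool :=
  [forall u in S, forall v in S, (u != v) ==> (dist u v == Some m)].

Definition eq_number (m : nat) : nat :=
  \max_(S : {set V} | equidistant m S) #|S|.

Lemma has_walkP m u v :
  reflect (exists p : seq V, [/\ size p = m, path e u p & last u p = v])
          (has_walk m u v).
Proof.
apply: (iffP existsP) => [[p /andP[pp /eqP <-]]|[p [sp pp lp]]].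
  by exists p; rewrite size_tuple.
have sp' : size p == m by apply/eqP.
by exists (Tuple sp'); rewrite /= pp lp eqxx.
Qed.

Lemma dist_SomeP u v m :
  dist u v = Some m <->
  has_walk m u v /\ (forall l, has_walk l u v -> m <= l).
Proof.
have short l : has_walk l u v -> exists2 l', l' <= l & has_walk l' u v && (l' < #|V|).
  case/has_walkP=> p [<- pp <-]; case/shortenP: (pp) => p' pp' up' sub.
  exists (size p'); first by case/andP: up' => _ up'; apply: uniq_leq_size.
  apply/andP; split; first by apply/has_walkP; exists p'.
  by rewrite -[(size p').+1]/(size (u :: p')) -(card_uniqP up') max_card.
pose s := [seq m <- iota 0 #|V| | has_walk m u v].
have srt : sorted ltn s by apply: sorted_filter (iota_ltn_sorted _ _); apply: ltn_trans.
have memE l : (l \in s) = has_walk l u v && (l < #|V|).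
  by rewrite mem_filter mem_iota.
have min_s l t : s = l :: t -> forall l', l' \in s -> l <= l'.
  move=> sE l'; move: srt; rewrite sE /= (path_sortedE ltn_trans) => /andP[/allP h _].
  by rewrite inE => /orP[/eqP->//|/h /ltnW].
rewrite /dist -/s; split.
  case sE : s => [|l t] //= [lm]; rewrite -{}lm; split.
    by have := memE l; rewrite sE mem_head => /esym/andP[].
  move=> l' /short [l2 l2l']; rewrite -memE => /(min_s _ _ sE) h.
  exact: leq_trans h l2l'.
case=> wm minm; have [l lm /andP[wl lV]] := short _ wm.
have {}lV : m < #|V| by apply: leq_ltn_trans (minm _ wl) lV.
have ms : m \in s by rewrite memE wm.
case sE : s ms => [|l0 t] // ms; congr Some; apply/eqP; rewrite eqn_leq.
rewrite (min_s _ _ sE) ?sE ?ms //= minm //.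
by have := memE l0; rewrite sE mem_head => /esym/andP[].
Qed.

End Graphs.

Section Spectra.
Variable R : realType.

Definition adjmx (V : finType) (e : rel V) : 'M[R]_#|V| :=
  \matrix_(i, j) (e (enum_val i) (enum_val j))%:R.

(* The real roots of the characteristic polynomial, in decreasing order. *)
Definition distinct_eigenvalues n (A : 'M[R]_n) : seq R :=
  rev (rootsR (char_poly A)).

Definition eigenvalues n (A : 'M[R]_n) : seq R :=
  flatten [seq nseq (mup x (char_poly A)) x | x <- distinct_eigenvalues A].

Lemma mem_distinct_eigenvalues n (A : 'M[R]_n) x :
  (x \in distinct_eigenvalues A) = eigenvalue A x.
Proof.
rewrite mem_rev eigenvalue_root_char.
have := roots_on_rootsR (monic_neq0 (char_poly_monic A)).
by move=> /(_ x); rewrite inE /= => <-.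
Qed.

Lemma distinct_eigenvalues_sorted n (A : 'M[R]_n) :
  sorted >%R (distinct_eigenvalues A).
Proof. by rewrite rev_sorted; apply: sorted_roots. Qed.

(* Eigenvalues with multiplicity are indexed from 1, as in
   lambda_1 >= ... >= lambda_n; the distinct ones, [theta], from 0. *)
Definition lambda (V : finType) (e : rel V) (j : nat) : R :=
  (eigenvalues (adjmx e))`_j.-1.

Definition theta (V : finType) (e : rel V) (j : nat) : R :=
  (distinct_eigenvalues (adjmx e))`_j.

(* [q(A)] for square matrices of any size; [horner_mx] exists only for sizes of
   the form [m.+1], where the two agree. *)
Definition mxeval n (A : 'M[R]_n) (q : {poly R}) : 'M[R]_n :=
  \sum_(i < size q) q`_i *: A ^+ i.

Lemma mxevalE m (A : 'M[R]_m.+1) (q : {poly R}) : mxeval A q = horner_mx A q.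
Proof.
rewrite -[q in RHS]coefK poly_def raddf_sum; apply: eq_bigr => i _ /=.
by rewrite linearZ /= rmorphXn /= horner_mx_X.
Qed.

(* Maximum and minimum of a nonempty sequence (0 if it is empty). *)
Definition seq_max (s : seq R) : R := \big[Num.max/head 0 s]_(x <- s) x.
Definition seq_min (s : seq R) : R := \big[Num.min/head 0 s]_(x <- s) x.

Section RatioBound.
Variables (V : finType) (e : rel V) (q : {poly R}).

Definition W : R := seq_max [seq mxeval (adjmx e) q u u | u : 'I_#|V|].

Definition lambda_min : R :=
  seq_min [seq q.[lambda e j] | j <- index_iota 2 #|V|.+1].

Definition ratio_bound : R :=
  #|V|%:R * ((W - lambda_min) / (q.[lambda e 1] - lambda_min)).

End RatioBound.
End Spectra.

(* Main.v *)
(* The diagonal of [q(A)] is constant, equal to [L(q) = q_0 + k q_2], for every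
   [q] of degree at most 2. The parabola [p] takes its minimum over the spectrum
   at the two consecutive eigenvalues [theta_i] and [theta_{i-1}], which gives
   the value of [R(p)]; the bound on [eq_3] expresses that [p(A) - lambda(p)] is
   positive semidefinite while [p(A)] has no off-diagonal entry between vertices
   at distance 3. For optimality, Lagrange interpolation yields
   [L(q) = alpha q(k) + beta q(theta_i) + gamma q(theta_{i-1})] with
   [alpha = R(p) / n] and [beta, gamma >= 0] because [theta_i <= -1 < theta_{i-1}];
   as [L(1) = 1], applying this to [q - lambda(q) >= 0] gives [R(q) >= R(p)]. *)
Require Import Defs.
From mathcomp Require Import all_boot all_order all_algebra.
From mathcomp Require Import spectral complex polyrcf reals ring lra.
Set Implicit Arguments.
Unset Strict Implicit.
Unset Printing Implicit Defensive.
Import Order.TTheory GRing.Theory Num.Theory.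
Local Open Scope ring_scope.

(** * Orthogonal diagonalization of real symmetric matrices *)

Lemma char_poly_similar_diag (R : comUnitRingType) n
    (P : 'M[R]_n) (d : 'rV[R]_n) :
  P \in unitmx ->
  char_poly (invmx P *m diag_mx d *m P) = \prod_i ('X - (d 0 i)%:P).
Proof.
move=> Pu; have -> : char_poly (invmx P *m diag_mx d *m P) = char_poly (diag_mx d).
  have PP : map_mx polyC (invmx P) *m map_mx polyC P = 1%:M.
    by rewrite -map_mxM mulVmx // map_mx1.
  (* Conjugation fixes the scalar matrix ['X%:M], so the whole characteristic matrix is a
     conjugate. *)
  have XE : 'X%:M = map_mx polyC (invmx P) *m 'X%:M *m map_mx polyC P.
    by rewrite scalar_mxC -mulmxA PP mulmx1.
  rewrite /char_poly /char_poly_mx !map_mxM [in LHS]XE -mulmxBl -mulmxBr.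
  by rewrite !det_mulmx mulrAC -det_mulmx PP det1 mul1r.
rewrite char_poly_trig ?diag_mx_is_trig //.
by apply: eq_bigr => i _; rewrite mxE eqxx.
Qed.

Lemma expmx_similar (R : comUnitRingType) n (P D : 'M[R]_n) m : P \in unitmx ->
  (invmx P *m D *m P) ^+ m = invmx P *m D ^+ m *m P.
Proof.
move=> Pu; elim: m => [|m IH]; first by rewrite !expr0 mulmx1 mulVmx.
by rewrite !exprS IH -!mulmxE !mulmxA mulmxK.
Qed.

Lemma diag_mxX (R : pzSemiRingType) n (d : 'rV[R]_n) m :
  diag_mx d ^+ m = diag_mx (\row_j d 0 j ^+ m).
Proof.
elim: m => [|m IH].
  by rewrite expr0; apply/matrixP=> i j; rewrite !mxE expr0.
rewrite exprS IH -mulmxE mulmx_diag; congr diag_mx.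
by apply/rowP=> j; rewrite !mxE exprS.
Qed.

(* The [w j] are the squared moduli of the coordinates of [x] in an orthonormal
   eigenbasis of [A]; this basis is found over the complex numbers. *)
Lemma symmetric_spectral (R : rcfType) n (A : 'M[R]_n) : A^T = A ->
  exists2 d : 'rV[R]_n, char_poly A = \prod_i ('X - (d 0 i)%:P) &
  forall x : 'rV[R]_n, exists2 w : 'I_n -> R, (forall j, 0 <= w j) &
    forall m, (x *m A ^+ m *m x^T) 0 0 = \sum_j w j * d 0 j ^+ m.
Proof.
move=> symA; pose f : {rmorphism R -> R[i]} := real_complex R.
pose B : 'M[R[i]]_n := map_mx f A.
have freal x : f x \is Num.real by apply/complex_realP; exists x.
have Bh : B \is hermsymmx.
  apply: realsym_hermsym.
    by apply/is_hermitianmxP; rewrite expr0 scale1r map_mx_id // /B map_trmx symA.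
  by apply/mxOverP => i j; rewrite mxE.
have Dr := hermitian_spectral_diag_real Bh.
have /orthomx_spectralP BE := hermitian_normalmx Bh.
set P := spectralmx B in BE; set D := spectral_diag B in BE Dr.
have Pu : P \is unitarymx by exact: spectral_unitarymx.
have Pi : P \in unitmx by exact: unitarymx_unit.
pose d : 'rV[R]_n := map_mx (@complex.Re R) D.
have fd : map_mx f d = D.
  apply/rowP=> j; rewrite !mxE.
  by have /mxOverP/(_ 0 j)/complex_realP[z ->] := Dr.
exists d.
  apply: (map_poly_inj f); rewrite map_char_poly -/B [in LHS]BE.
  rewrite char_poly_similar_diag // rmorph_prod; apply: eq_bigr => j _.
  by rewrite /= map_polyXsubC -fd mxE.
move=> x; pose y := map_mx f x *m invmx P.
(* As [P] is unitary and [x] is real, this column is the conjugate transpose of [y]; the form then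
   becomes a sum of squared moduli. *)
have yE : P *m (map_mx f x)^T = (y ^t*)%sesqui.
  rewrite /y invmx_unitary // trmx_mul map_mxM trmxCK; congr (_ *m _).
  by apply/matrixP=> i j; rewrite !mxE; apply/esym/CrealP.
exists (fun j => complex.Re (`|y 0 j| ^+ 2)) => [j|m].
  have : 0 <= `|y 0 j| ^+ 2 by rewrite exprn_ge0.
  by case: (_ ^+ 2) => a b; rewrite lecE /= => /andP[].
have fI : injective f by exact: complexI.
apply: fI; rewrite rmorph_sum.
transitivity ((map_mx f x *m B ^+ m *m (map_mx f x)^T) 0 0).
  have -> : B ^+ m = map_mx f (A ^+ m).
    rewrite /B; elim: m => [|m IH].
      by rewrite !expr0; apply/esym/map_mx1.
    by rewrite !exprS IH -!mulmxE map_mxM.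
  by rewrite map_trmx -!map_mxM [in RHS]mxE.
rewrite BE expmx_similar // diag_mxX !mulmxA -/y -mulmxA yE.
rewrite mxE; apply: eq_bigr => j _; clearbody y.
rewrite mul_mx_diag !mxE -fd mxE mulrAC -normCK rmorphM rmorphXn.
by congr (_ * _); apply/esym/RRe_real; rewrite rpredX ?normr_real.
Qed.

(** * Eigenvalues listed with multiplicity *)

Lemma mup_prod_XsubC (F : fieldType) (x : F) (s : seq F) :
  mup x (\prod_(y <- s) ('X - y%:P)) = count_mem x s.
Proof.
elim: s => [|y s IH]; first by rewrite big_nil mupNroot // root1.
rewrite big_cons mupM ?polyXsubC_eq0 ?monic_neq0 ?monic_prod_XsubC //= IH.
by rewrite -['X - _]expr1 mup_XsubCX; case: eqP.
Qed.

(** The multiplicity of a root is its number of occurrences in [s], so grouping [s] by value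
    rebuilds [eigenvalues A]. *)
Lemma perm_eigenvalues (R : realType) n (A : 'M[R]_n) (s : seq R) :
  char_poly A = \prod_(y <- s) ('X - y%:P) -> perm_eq (eigenvalues A) s.
Proof.
move=> As; rewrite -(permPr (perm_count_undup s)) /eigenvalues.
under eq_map => x do rewrite As mup_prod_XsubC.
apply/perm_flatten/perm_map/uniq_perm; rewrite ?undup_uniq //.
  by rewrite rev_uniq uniq_roots.
move=> x; rewrite mem_distinct_eigenvalues eigenvalue_root_char As.
by rewrite root_prod_XsubC mem_undup.
Qed.

Lemma size_eigenvalues (R : realType) n (A : 'M[R]_n) :
  A^T = A -> size (eigenvalues A) = n.
Proof.
case/symmetric_spectral=> d dA _.
have /perm_eigenvalues/perm_size-> :
    char_poly A = \prod_(y <- [seq d 0 i | i : 'I_n]) ('X - y%:P).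
  by rewrite dA big_map big_enum.
by rewrite size_map size_enum_ord.
Qed.

Lemma mup_eigenvalue_gt0 (R : realType) n (A : 'M[R]_n) x :
  x \in distinct_eigenvalues A -> (0 < mup x (char_poly A))%N.
Proof.
rewrite mem_distinct_eigenvalues eigenvalue_root_char => rx.
by rewrite -XsubC_dvd ?dvdp_XsubCl // monic_neq0 // char_poly_monic.
Qed.

Lemma mem_eigenvalues (R : realType) n (A : 'M[R]_n) :
  eigenvalues A =i distinct_eigenvalues A.
Proof.
move=> x; apply/flatten_mapP/idP => [[y yA]|xA].
  by rewrite mem_nseq => /andP[_ /eqP->].
by exists x => //; rewrite mem_nseq mup_eigenvalue_gt0 /=.
Qed.

(** In an orthonormal eigenbasis the form is a combination of the values of [q] at the eigenvalues,
    with nonnegative weights [w j]. *)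
Lemma symmetric_quadratic_form_ge0 (R : realType) n (A : 'M[R]_n) (q : {poly R}) :
  A^T = A -> (forall x, x \in distinct_eigenvalues A -> 0 <= q.[x]) ->
  forall x : 'rV_n, 0 <= (x *m mxeval A q *m x^T) 0 0.
Proof.
case/symmetric_spectral=> d dA wA q0 x; have [w w0 wE] := wA x.
suff -> : (x *m mxeval A q *m x^T) 0 0 = \sum_j w j * q.[d 0 j].
  apply: sumr_ge0 => j _; rewrite mulr_ge0 // q0 //.
  rewrite mem_distinct_eigenvalues eigenvalue_root_char dA.
  by rewrite (bigD1 j) //= rootM root_XsubC eqxx.
rewrite /mxeval mulmx_sumr mulmx_suml summxE.
under eq_bigr do rewrite -scalemxAr -scalemxAl mxE wE mulr_sumr.
rewrite exchange_big; apply: eq_bigr => j _.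
rewrite horner_coef mulr_sumr; apply: eq_bigr => i _.
by rewrite mulrCA.
Qed.

(** * Extrema of sequences, semidefinite matrices and quadratic polynomials of a matrix *)

Lemma seq_min_le (R : realType) (s : seq R) x : x \in s -> seq_min s <= x.
Proof. by move=> xs; exact: (@ge_bigmin_seq _ _ _ _ _ x xpredT id). Qed.

Lemma seq_min_ge (R : realType) (s : seq R) c :
  s != [::] -> {in s, forall x, c <= x} -> c <= seq_min s.
Proof.
case: s => // x s _ cs; rewrite /seq_min big_seq.
by apply: le_bigmin => [|y /cs//]; rewrite cs ?mem_head.
Qed.

Lemma seq_max_const (R : realType) (s : seq R) c :
  s != [::] -> {in s, forall x, x = c} -> seq_max s = c.
Proof.
case: s => // x s _ cs; rewrite /seq_max big_seq.
apply: (big_ind (fun y => y = c)) => [|y z -> ->|y ys]; last exact: cs.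
  exact/cs/mem_head.
exact: maxxx.
Qed.

Lemma entryD (R : nmodType) m n (M N : 'M[R]_(m, n)) i j :
  (M + N) i j = M i j + N i j.
Proof. exact: mxE. Qed.

Lemma entryZ (R : pzRingType) m n c (M : 'M[R]_(m, n)) i j :
  (c *: M) i j = c * M i j.
Proof. exact: mxE. Qed.

(** With a zero diagonal, the form at the sum and at the difference of two basis vectors is plus and
    minus twice an entry, which must therefore vanish. *)
Lemma psd_diag0_eq0 (R : realDomainType) n (M : 'M[R]_n) :
  M^T = M -> (forall x : 'rV_n, 0 <= (x *m M *m x^T) 0 0) ->
  (forall u, M u u = 0) -> M = 0.
Proof.
move=> Msym Mpsd Mdiag; apply/matrixP => u v; rewrite mxE.
have Mvu : M v u = M u v by rewrite -[in LHS]Msym mxE.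
pose d i : 'rV[R]_n := delta_mx 0 i.
have dE i j : (d i *m M *m (d j)^T) 0 0 = M i j.
  by rewrite trmx_delta -rowE -colE !mxE.
have expand c :
    ((d u + c *: d v) *m M *m (d u + c *: d v)^T) 0 0 = (c * M u v) *+ 2.
  rewrite linearD linearZ /= !mulmxDl !mulmxDr -!scalemxAl -!scalemxAr.
  rewrite !(entryD, entryZ, dE) !Mdiag Mvu.
  by rewrite !mulr0 addr0 add0r mulr2n.
have := Mpsd (d u + 1 *: d v).
have := Mpsd (d u + -1 *: d v).
by rewrite !expand; lra.
Qed.

Lemma mxeval_quadratic (R : realType) n (M : 'M[R]_n) (q : {poly R}) :
  (size q <= 3)%N ->
  mxeval M q = q`_0 *: 1%:M + q`_1 *: M + q`_2 *: (M *m M).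
Proof.
move=> q3; transitivity (\sum_(i < 3) q`_i *: M ^+ i).
  rewrite /mxeval (big_ord_widen _ (fun i => q`_i *: M ^+ i) q3) big_mkcond.
  apply: eq_bigr => i _; case: ltnP => // qi.
  by rewrite nth_default // scale0r.
by rewrite !big_ord_recl big_ord0 addr0 addrA expr0 expr1 expr2.
Qed.

Lemma eigenvector_mxeval (R : realType) n (M : 'M[R]_n) (v : 'rV_n) x q :
  v *m M = x *: v -> v *m mxeval M q = q.[x] *: v.
Proof.
move=> vM; rewrite horner_coef scaler_suml mulmx_sumr; apply: eq_bigr => i _.
rewrite -scalemxAr -scalerA; congr (_ *: _).
elim: (nat_of_ord i) => [|m IH]; first by rewrite !expr0 mulmx1 scale1r.
by rewrite !exprS -mulmxE mulmxA vM -scalemxAl IH scalerA.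
Qed.

(** * Matching the distinct eigenvalues with the eigenvalues counted with multiplicity *)

Section Adjacency.
Variables (R : realType) (V : finType) (e : rel V).
Hypothesis e_sym : symmetric e.

Let A := adjmx R e.
Let th := distinct_eigenvalues A.

Lemma tr_adjmx : A^T = A.
Proof. by apply/matrixP => i j; rewrite !mxE e_sym. Qed.

Lemma lambda1 : (0 < size th)%N -> lambda R e 1 = theta R e 0.
Proof.
rewrite /lambda /theta /eigenvalues -/A -/th => th0.
have : (0 < mup th`_0 (char_poly A))%N by rewrite mup_eigenvalue_gt0 ?mem_nth.
by case: th => [|x s] //=; case: (mup x _).
Qed.

Lemma lambda_mem j : (0 < j <= #|V|)%N -> lambda R e j \in th.
Proof.
case: j => // j /= jV; rewrite -mem_eigenvalues mem_nth //.
by rewrite size_eigenvalues ?tr_adjmx.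
Qed.

Lemma theta_lambda m : (0 < m < size th)%N ->
  exists2 j, (2 <= j <= #|V|)%N & lambda R e j = theta R e m.
Proof.
case/andP=> m0 mth; pose x := theta R e m.
have sE := size_eigenvalues (tr_adjmx).
have xE : x \in eigenvalues A by rewrite mem_eigenvalues mem_nth.
have x0 : x != theta R e 0.
  rewrite /x /theta nth_uniq -?lt0n //; first exact: leq_trans mth.
  by rewrite rev_uniq uniq_roots.
(* First occurrence of [x], shifted because [lambda] is indexed from 1. The list starts with
   [theta R e 0], which differs from [x], so the position is at least 2. *)
exists (index x (eigenvalues A)).+1; last by rewrite /lambda /= nth_index.
have iV : (index x (eigenvalues A) < #|V|)%N by rewrite -{2}sE index_mem.
rewrite iV andbT ltnS lt0n.
apply: contra x0 => /eqP ix.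
rewrite -lambda1; last exact: leq_trans mth.
by rewrite /lambda /= -ix nth_index.
Qed.

Lemma distinct_eigenvalues_card : (0 < size th)%N -> (0 < #|V|)%N.
Proof.
move=> th0; rewrite -(size_eigenvalues tr_adjmx).
have : th`_0 \in eigenvalues A by rewrite mem_eigenvalues mem_nth.
by case: eigenvalues.
Qed.

Lemma lambda_min_le (q : {poly R}) m : (0 < m < size th)%N ->
  lambda_min e q <= q.[theta R e m].
Proof.
case/theta_lambda => j j2 <-; apply/seq_min_le/mapP.
by exists j; rewrite // mem_index_iota ltnS.
Qed.

Lemma lambda_min_ge (q : {poly R}) c : (1 < size th)%N ->
  (forall x, x \in th -> c <= q.[x]) -> c <= lambda_min e q.
Proof.
move=> th1 cq; apply: seq_min_ge => [|_ /mapP[j jV ->]].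
  (* A second distinct eigenvalue makes the range of [j] nonempty, so [seq_min] does not fall back
     to 0. *)
  have [|j /andP[j2 jV] _] := @theta_lambda 1; first by rewrite th1.
  by rewrite -size_eq0 size_map size_iota subn_eq0 -ltnNge ltnS (leq_trans j2).
move: jV; rewrite mem_index_iota ltnS => /andP[j2 jV].
by rewrite cq // lambda_mem // jV (leq_trans _ j2).
Qed.

End Adjacency.

Lemma theta_lt (R : realType) (V : finType) (e : rel V) i j :
  (i < j < size (distinct_eigenvalues (adjmx R e)))%N ->
  theta R e j < theta R e i.
Proof.
case/andP=> ij jd; apply: (sorted_ltn_nth (rev_trans lt_trans)) => //.
  exact: distinct_eigenvalues_sorted.
exact: ltn_trans jd.
Qed.

(** * Regular graphs: largest eigenvalue, diagonal of [q(A)], ratio bound *)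

Section Regular.
Variables (R : realType) (V : finType) (e : rel V) (k : nat).
Hypotheses (e_sym : symmetric e) (e_irr : irreflexive e) (e_reg : regular e k).

Let A := adjmx R e.
Let th := distinct_eigenvalues A.
Let one : 'rV[R]_#|V| := const_mx 1.

Lemma sum_adjmx u : \sum_v A u v = k%:R.
Proof.
rewrite -(e_reg (enum_val u)) -sum1_card natr_sum.
transitivity (\sum_(v in V) (e (enum_val u) v)%:R : R).
  by rewrite [RHS]big_enum_val; apply: eq_bigr => v _; rewrite mxE.
by rewrite [RHS]big_mkcond; apply: eq_bigr => v _; rewrite inE; case: (e _ _).
Qed.

Lemma one_mul_adjmx : one *m A = k%:R *: one.
Proof.
apply/rowP => v; rewrite !mxE mulr1 -(sum_adjmx v); apply: eq_bigr => u _.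
by rewrite !mxE mul1r e_sym.
Qed.

Lemma adjmx_sqr_diag u : (A *m A) u u = k%:R.
Proof.
rewrite mxE -(sum_adjmx u); apply: eq_bigr => v _.
by rewrite !mxE [e (enum_val v) _]e_sym -natrM mulnb andbb.
Qed.

(** There are no loops, and the closed walks of length 2 at a vertex correspond to its [k]
    neighbours. *)
Lemma mxeval_diag (q : {poly R}) u : (size q <= 3)%N ->
  mxeval A q u u = q`_0 + q`_2 * k%:R.
Proof.
move=> q3; rewrite mxeval_quadratic // !mxE eqxx e_irr mulr1 mulr0 addr0.
by rewrite -(adjmx_sqr_diag u) mxE.
Qed.

Lemma W_regular (q : {poly R}) : (0 < #|V|)%N -> (size q <= 3)%N ->
  W e q = q`_0 + q`_2 * k%:R.
Proof.
move=> V0 q3; apply: seq_max_const => [|_ /mapP[u _ ->]].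
  by rewrite -size_eq0 size_map size_enum_ord -lt0n.
exact: mxeval_diag.
Qed.

Lemma adjmx_eigenvalue_le x : eigenvalue A x -> x <= k%:R.
Proof.
case/eigenvalueP => v vA v0.
have [u0 _] : exists u, v 0 u != 0.
  by apply/existsP; apply: contra_neqT v0 => /existsPn h; apply/rowP => u;
     rewrite mxE; apply/eqP/negbNE/h.
(* At an entry of largest modulus, the eigenvalue equation bounds [x] by a row sum of [A]. *)
pose u := [arg max_(i > u0) `|v 0 i|]%O.
have um i : `|v 0 i| <= `|v 0 u|.
  by rewrite /u; case: arg_maxP => // j _; apply.
have vu : 0 < `|v 0 u|.
  rewrite normr_gt0; apply: contra v0 => /eqP vu0; apply/eqP/rowP => i.
  by rewrite mxE; apply/eqP; rewrite -normr_le0 (le_trans (um i)) // vu0 normr0.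
rewrite (le_trans (ler_norm x)) // -(ler_pM2r vu) -normrM.
have /rowP/(_ u) := vA; rewrite !mxE => <-.
rewrite (le_trans (ler_norm_sum _ _ _)) // -(sum_adjmx u) mulr_suml.
apply: ler_sum => i _; rewrite normrM mulrC !mxE e_sym.
by rewrite normr_nat ler_wpM2l ?ler0n.
Qed.

Lemma theta0_regular : (0 < #|V|)%N -> theta R e 0 = k%:R.
Proof.
move=> V0; have kA : k%:R \in distinct_eigenvalues A.
  rewrite mem_distinct_eigenvalues; apply/eigenvalueP; exists one.
    exact: one_mul_adjmx.
  apply/negP => /eqP/rowP/(_ (Ordinal V0)); rewrite !mxE => /eqP.
  by rewrite oner_eq0.
have srt := distinct_eigenvalues_sorted A.
apply/eqP; rewrite eq_le; apply/andP; split.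
  apply: adjmx_eigenvalue_le; rewrite -mem_distinct_eigenvalues mem_nth //.
  by case: distinct_eigenvalues kA.
rewrite /theta -/A; case: distinct_eigenvalues kA srt => // x s.
rewrite inE => /predU1P[->//|ks] /=; rewrite (path_sortedE (rev_trans lt_trans)).
by case/andP=> /allP/(_ _ ks)/ltW.
Qed.

Lemma tr_mxeval_adjmx (q : {poly R}) : (size q <= 3)%N ->
  (mxeval A q)^T = mxeval A q.
Proof.
move=> q3; rewrite mxeval_quadratic // !linearD !linearZ /= trmx_mul trmx1.
by rewrite tr_adjmx.
Qed.

(* Otherwise [(x - k) * (x + 1)] is nonnegative on the spectrum; as its value at
   [A] has zero diagonal, it vanishes at [A], so that [k] and [-1] are the only
   eigenvalues. *)
Lemma theta1_gtN1 : (2 < size th)%N -> -1 < theta R e 1.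
Proof.
move=> th2; rewrite ltNge; apply/negP => th1_le.
have V0 : (0 < #|V|)%N.
  exact: distinct_eigenvalues_card e_sym (ltn_trans _ th2).
have th0 := theta0_regular V0.
pose q : {poly R} := 'X^2 + (1 - k%:R) *: 'X - k%:R%:P.
have q3 : (size q <= 3)%N.
  apply/leq_sizeP => j j3; rewrite !coefE.
  by case: j j3 => [|[|[|j]]] //= _; rewrite mulr0 subr0 addr0.
have qE x : q.[x] = (x - k%:R) * (x + 1) by rewrite !hornerE; ring.
have q0 x : x \in th -> 0 <= q.[x].
  case/(nthP 0) => [[|m] mth <-]; rewrite qE.
    by rewrite [_`_0]th0 subrr mul0r.
  have : th`_m.+1 <= -1.
    case: m mth => [//|m] mth; apply: le_trans th1_le.
    by apply/ltW/theta_lt; rewrite mth.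
  have : 0 <= k%:R :> R by rewrite ler0n.
  nra.
have Aq0 : mxeval A q = 0.
  apply: psd_diag0_eq0; first exact: tr_mxeval_adjmx.
    exact: symmetric_quadratic_form_ge0 (tr_adjmx R e_sym) q0.
  by move=> u; rewrite mxeval_diag // !coefE /=; ring.
have root_q m : (0 < m < size th)%N -> theta R e m = -1.
  case/andP=> m0 mth.
  have : theta R e m \in th by exact: mem_nth.
  rewrite mem_distinct_eigenvalues => /eigenvalueP[v vA v0].
  have := eigenvector_mxeval q vA; rewrite Aq0 mulmx0 => /esym/eqP.
  rewrite scaler_eq0 (negPf v0) orbF qE mulf_eq0 subr_eq0 -th0.
  rewrite lt_eqF ?theta_lt ?m0 //= addr_eq0 => /eqP//.
have t2 : theta R e 2 = -1 by rewrite root_q // th2.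
have t1 : theta R e 1 = -1 by apply: root_q; exact: ltnW th2.
by have := @theta_lt R V e 1 2 th2; rewrite t1 t2 ltxx.
Qed.

(** Two vertices at distance 3 are distinct, nonadjacent and without common neighbour, so [1], [A]
    and [A *m A] all vanish there. *)
Lemma equidistant_mxeval (S : {set V}) (q : {poly R}) u v : (size q <= 3)%N ->
  equidistant e 3 S -> enum_val u \in S -> enum_val v \in S -> u != v ->
  mxeval A q u v = 0.
Proof.
move=> q3 /forall_inP eqS uS vS uv.
have /forall_inP/(_ _ vS)/implyP := eqS _ uS.
rewrite (inj_eq enum_val_inj) => /(_ uv)/eqP/dist_SomeP[_ minw].
have e0 : e (enum_val u) (enum_val v) = false.
  apply/negP => euv; suff /minw : has_walk e 1 (enum_val u) (enum_val v) by [].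
  by apply/has_walkP; exists [:: enum_val v]; rewrite /= euv.
have AA0 : (A *m A) u v = 0.
  rewrite mxE big1 // => w _; rewrite !mxE -natrM mulnb.
  case: andP => // [[euw ewv]].
  suff /minw : has_walk e 2 (enum_val u) (enum_val v) by [].
  by apply/has_walkP; exists [:: enum_val w; enum_val v]; rewrite /= euw ewv.
rewrite mxeval_quadratic // 2!mxE [(_ *: (A *m A)) u v]mxE AA0 !mxE e0.
by rewrite (negPf uv) !mulr0 !addr0.
Qed.

(* The nonnegative quadratic form of [q(A) - c] is evaluated at the projection
   of the indicator vector of [S] on the orthogonal complement of [one]. *)
Lemma equidistant_ratio_bound (S : {set V}) (q : {poly R}) c :
  (size q <= 3)%N -> (forall x, x \in th -> c <= q.[x]) ->
  equidistant e 3 S -> S != set0 ->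
  #|S|%:R * (q.[k%:R] - c) <= #|V|%:R * (q`_0 + q`_2 * k%:R - c).
Proof.
move=> q3 qc eqS S0.
pose r := q - c%:P; pose N := mxeval A r.
have r3 : (size r <= 3)%N.
  rewrite (leq_trans (size_polyD _ _)) // geq_max q3 size_polyN.
  exact: leq_trans (size_polyC_leq1 _) _.
have rE x : r.[x] = q.[x] - c by rewrite !hornerE.
have r0 x : x \in th -> 0 <= r.[x] by rewrite rE subr_ge0; apply: qc.
have [s_gt0 V0] : (0 < #|S| /\ 0 < #|V|)%N.
  rewrite card_gt0; split=> //.
  by apply: leq_trans (max_card (mem S)); rewrite card_gt0.
pose x : 'rV[R]_#|V| := \row_u (enum_val u \in S)%:R.
have onex : (one *m x^T) 0 0 = #|S|%:R.
  rewrite mxE -sum1_card natr_sum [RHS]big_mkcond [RHS]big_enum_val.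
  by apply: eq_bigr => u _; rewrite !mxE mul1r; case: (_ \in S).
have oneone : (one *m one^T) 0 0 = #|V|%:R.
  rewrite mxE; under eq_bigr do rewrite !mxE mulr1.
  by rewrite sumr_const card_ord.
have oneN : one *m N = r.[k%:R] *: one.
  exact/eigenvector_mxeval/one_mul_adjmx.
have Nsym : N^T = N by exact: tr_mxeval_adjmx.
have oneNx : (one *m N *m x^T) 0 0 = r.[k%:R] * #|S|%:R.
  by rewrite oneN -scalemxAl mxE onex.
have xNone : (x *m N *m one^T) 0 0 = r.[k%:R] * #|S|%:R.
  suff -> : x *m N *m one^T = (one *m N *m x^T)^T by rewrite mxE.
  by rewrite !trmx_mul trmxK Nsym mulmxA.
(* Only the diagonal of [N] contributes, since its entries between distinct vertices of [S] are
   zero. *)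
have xNx : (x *m N *m x^T) 0 0 = #|S|%:R * (r`_0 + r`_2 * k%:R).
  rewrite -sum1_card natr_sum mulr_suml [RHS]big_mkcond [RHS]big_enum_val mxE.
  apply: eq_bigr => u _; rewrite !mxE.
  case: ifP => uS; last by rewrite mulr0.
  rewrite mulr1 mul1r (bigD1 u) //= mxE uS mul1r mxeval_diag //.
  rewrite big1 ?addr0 // => v vu; rewrite mxE.
  case vS : (_ \in S); last by rewrite mul0r.
  by rewrite mul1r (equidistant_mxeval r3 eqS).
have oneNone : (one *m N *m one^T) 0 0 = r.[k%:R] * #|V|%:R.
  by rewrite oneN -scalemxAl mxE oneone.
have r02 : r`_0 + r`_2 * k%:R = q`_0 + q`_2 * k%:R - c.
  by rewrite !coefE /= subr0 addrAC.
(* The coefficient for which [x + a *: one] is orthogonal to [one]. *)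
pose a : R := - (#|S|%:R / #|V|%:R).
have := symmetric_quadratic_form_ge0 (tr_adjmx R e_sym) r0 (x + a *: one).
rewrite -/N; have -> : (x + a *: one)^T = x^T + a *: one^T.
  by rewrite linearD linearZ.
rewrite !mulmxDl !mulmxDr -!scalemxAl -!scalemxAr.
rewrite !(entryD, entryZ) xNx oneNx xNone oneNone r02 -rE.
set n : R := #|V|%:R; set s : R := #|S|%:R; set t := _ - c.
have n0 : 0 < n by rewrite ltr0n.
have s0 : 0 < s by rewrite ltr0n.
have -> : s * t + a * (r.[k%:R] * s) +
    (a * (r.[k%:R] * s) + a * (a * (r.[k%:R] * n))) =
    s / n * (n * t - s * r.[k%:R]).
  by rewrite /a -/s -/n; field; rewrite gt_eqF.
by rewrite pmulr_rge0 ?divr_gt0 // subr_ge0.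
Qed.

End Regular.

(** * The value of the bound and its optimality *)

Lemma equidistant1 (V : finType) (e : rel V) m u : equidistant e m [set u].
Proof.
by apply/forall_inP => v /set1P->; apply/forall_inP => w /set1P->; rewrite eqxx.
Qed.

Lemma horner_quadratic (R : comNzRingType) (q : {poly R}) x : (size q <= 3)%N ->
  q.[x] = q`_0 + q`_1 * x + q`_2 * x ^+ 2.
Proof.
move=> q3; rewrite (horner_coef_wide _ q3) !big_ord_recl big_ord0 /=.
by rewrite addr0 expr0 expr1 mulr1 addrA.
Qed.

Theorem corollary17 (R : realType) (V : finType) (e : rel V) (k d i : nat)
  (e_sym : symmetric e) (e_irr : irreflexive e)
  (e_reg : regular e k)
  (hd : size (distinct_eigenvalues (adjmx R e)) = d.+1) (d_ge2 : (2 <= d)%N)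
  (* theta_i is the largest eigenvalue that is at most -1 *)
  (i_le_d : (i <= d)%N) (theta_i_le : theta R e i <= -1)
  (theta_i_largest : forall j : nat, (j <= d)%N ->
     theta R e j <= -1 -> theta R e j <= theta R e i) :
  let p : {poly R} := 'X^2 - (theta R e i + theta R e i.-1) *: 'X in
  [/\ lambda_min e p < p.[lambda R e 1],
      (eq_number e 3)%:R <= ratio_bound e p,
      ratio_bound e p =
        #|V|%:R * ((theta R e 0 + theta R e i * theta R e i.-1) /
          ((theta R e 0 - theta R e i) * (theta R e 0 - theta R e i.-1)))
    & forall q : {poly R}, (size q <= 3)%N ->
        lambda_min e q < q.[lambda R e 1] ->
        ratio_bound e p <= ratio_bound e q].
Proof.
move=> p; set th := distinct_eigenvalues _ in hd.
have th2 : (2 < size th)%N by rewrite hd ltnS.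
have V0 : (0 < #|V|)%N by apply: distinct_eigenvalues_card e_sym (ltn_trans _ th2).
have th0 : theta R e 0 = k%:R by apply: theta0_regular.
have k0 : 0 <= k%:R :> R by rewrite ler0n.
(* [theta_0 = k >= 0] and [theta_1 > -1] exclude the indices 0 and 1. Hence [theta_{i-1}] is not
   [theta_0] and occurs among the [lambda_j] with [j >= 2]. *)
have i2 : (1 < i)%N.
  case: i theta_i_le {p i_le_d theta_i_largest} => [|[|//]] th_le.
    by exfalso; move: th_le; rewrite th0; lra.
  by have := theta1_gtN1 e_sym e_irr e_reg th2; rewrite ltNge th_le.
have lam1 : lambda R e 1 = k%:R by rewrite lambda1 ?th0 // hd.
rewrite lam1 th0.
have i_th : (0 < i < size th)%N by rewrite hd ltnS i_le_d ltnW.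
have i1_th : (0 < i.-1 < size th)%N.
  by rewrite hd ltnS (leq_trans (leq_pred i)) // andbT -ltnS prednK // ltnW.
have ab : theta R e i < theta R e i.-1.
  by apply: theta_lt; rewrite prednK ?(ltnW i2) // leqnn; case/andP: i_th.
have bk : theta R e i.-1 < k%:R by rewrite -th0 theta_lt.
have b_gtN1 : -1 < theta R e i.-1.
  rewrite ltNge; apply/negP => /theta_i_largest.
  by rewrite leNgt ab => /(_ (leq_trans (leq_pred i) i_le_d)).
(* No eigenvalue lies strictly between two consecutive ones. *)
have gap x : x \in th -> 0 <= (x - theta R e i) * (x - theta R e i.-1).
  case/(nthP 0) => m mth <-; rewrite -[_`_m]/(theta R e m).
  have [im|mi] := leqP i m.
    suff : theta R e m <= theta R e i by move: ab; nra.
    have [->//|mi] := eqVneq m i; apply/ltW/theta_lt.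
    by rewrite ltn_neqAle eq_sym mi im.
  suff : theta R e i.-1 <= theta R e m by move: ab; nra.
  have [->//|mi'] := eqVneq m i.-1; apply/ltW/theta_lt.
  case/andP: i1_th => _ ->; rewrite andbT ltn_neqAle mi' /=.
  by rewrite -ltnS prednK // ltnW.
set a := theta R e i in theta_i_le p ab gap *.
set b := theta R e i.-1 in p ab bk b_gtN1 gap *.
have pE x : p.[x] = (x - a) * (x - b) - a * b by rewrite !hornerE; ring.
have p3 : (size p <= 3)%N.
  apply/leq_sizeP => j j3; rewrite !coefE.
  by case: j j3 => [|[|[|j]]] //= _; rewrite mulr0 subr0.
have p_ge x : x \in th -> - (a * b) <= p.[x].
  by move=> /gap; rewrite pE; lra.
(* The lower bound [p_ge] is attained at [a], which is some [lambda_j] with [j >= 2]. *)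
have lam_p : lambda_min e p = - (a * b).
  apply/eqP; rewrite eq_le (lambda_min_ge e_sym) ?(ltnW th2) // andbT.
  by rewrite (le_trans (lambda_min_le e_sym p i_th)) // pE subrr mul0r sub0r.
have gap_gt0 : 0 < (k%:R - a) * (k%:R - b).
  by rewrite mulr_gt0 // subr_gt0 // (lt_trans ab).
have WE := W_regular e_sym e_irr e_reg V0.
have Wp : W e p = k%:R by rewrite WE // !coefE /= mulr0 !subr0 add0r mul1r.
have RE : ratio_bound e p =
    #|V|%:R * ((k%:R + a * b) / ((k%:R - a) * (k%:R - b))).
  by rewrite /ratio_bound lam1 lam_p Wp pE !opprK subrK.
split=> // [||q q3].
- by rewrite lam_p pE; lra.
- have eqR (S : {set V}) : equidistant e 3 S -> S != set0 ->
      #|S|%:R <= ratio_bound e p.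
    move=> eqS S0; rewrite RE mulrA ler_pdivlMr //.
    have := equidistant_ratio_bound e_sym e_irr e_reg p3 p_ge eqS S0.
    by rewrite -WE // Wp pE !opprK subrK.
  have /card_gt0P[u _] := V0.
  (* A single vertex is equidistant, so the bound is positive; this covers the empty set and the
     initial value 0 of the maximum. *)
  have R1 : 1 <= ratio_bound e p.
    have := eqR _ (equidistant1 e 3 u); rewrite cards1; apply.
    by rewrite -card_gt0 cards1.
  rewrite /eq_number; apply: (big_ind (fun m => m%:R <= ratio_bound e p)).
  + exact: le_trans ler01 R1.
  + by move=> m n; case: (leqP m n).
  + move=> S eqS; have [->|] := eqVneq S set0; last exact: eqR.
    by rewrite cards0 (le_trans ler01).
move=> lam_q; rewrite RE /ratio_bound lam1 ler_wpM2l ?ler0n //.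
set c := lambda_min e q in lam_q *.
have qa : c <= q.[a] by exact: lambda_min_le.
have qb : c <= q.[b] by exact: lambda_min_le.
rewrite ler_pdivrMr // mulrAC ler_pdivlMr ?subr_gt0 // WE //.
(* Multiplying by [b - a] clears the denominator left in the Lagrange weights at [a] and [b]. *)
have ba : 0 < b - a by rewrite subr_gt0.
rewrite -subr_ge0 -(pmulr_rge0 _ ba).
(* Lagrange interpolation at [k], [a], [b] writes the linear form [q`_0 + q`_2 * k]
   with nonnegative weights, the one of [q.[k]] being [R(p) / n]. *)
have -> : (b - a) * ((q`_0 + q`_2 * k%:R - c) * ((k%:R - a) * (k%:R - b)) -
      (k%:R + a * b) * (q.[k%:R] - c)) =
    k%:R * (1 + b) * (k%:R - b) * (q.[a] - c) +
    k%:R * (- 1 - a) * (k%:R - a) * (q.[b] - c).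
  by rewrite !(horner_quadratic _ q3); ring.
rewrite addr_ge0 // !mulr_ge0 // ?subr_ge0 //; lra.
Qed.
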